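(* Let $\mathbb K$ be $\mathbb R$ or $\mathbb C$, let $f=A+\sum_{j\geq 2}f_j$ be a formal power series vector field on $\mathbb K^n$ in Poincaré–Dulac normal form, and let $g=\sum_k g_k$ be a formal power series vector field such that $[g,f]=0$. Then $[g,A_s]=0$.
   Context: A formal (power series) vector field on $\mathbb K^n$ is a formal sum $g=\sum_{k\geq0} g_k$ with each $g_k:\mathbb K^n\to\mathbb K^n$ a homogeneous polynomial map of degree $k$ (equivalently, an element of $\mathbb K[[x_1,\ldots,x_n]]^n$). In $f=A+\sum_{j\geq2}f_j$, $A\in\mathbb K^{(n,n)}$ is a matrix, identified with the linear vector field $x\mapsto Ax$, and $f_j$ is homogeneous of degree $j$. The Lie bracket is $[f,g]=Dg\, f-Df\, g$. $A=A_s+A_n$ denotes the Jordan–Chevalley decomposition ($A_s$ semisimple, $A_n$ nilpotent, $[A_s,A_n]=0$). The vector field $f$ is said to be in Poincaré–Dulac normal form if $[A_s,f]=0$ (equivalently, $[A_s,f_j]=0$ for all $j$). *)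

(* Defs.v *)
From mathcomp Require Import all_boot all_order all_algebra.
From mathcomp Require Import boolp reals complex mpoly.

Set Implicit Arguments.
Unset Strict Implicit.
Unset Printing Implicit Defensive.

Import GRing.Theory.
Local Open Scope ring_scope.

Variant scalars := RealScalars | ComplexScalars.

Definition scalar_field (R : realType) (s : scalars) : fieldType :=
  match s with RealScalars => R | ComplexScalars => R[i] end.

(* Polynomials stand for polynomial maps: K is infinite where this is used. *)
Notation pvfield K n := 'cV[{mpoly K[n]}]_n.

Section PolynomialVectorFields.
Variables (K : fieldType) (n : nat).

Implicit Types (u v : pvfield K n).

Definition vfhomog (d : nat) v : bool := [forall i, v i 0 \is d.-homog].

Definition Dmx v : 'M[{mpoly K[n]}]_n := \matrix_(i, j) (v i 0)^`M(j).

Definition lie u v : pvfield K n := Dmx v *m u - Dmx u *m v.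

Definition linvf (A : 'M[K]_n) : pvfield K n :=
  map_mx (mpolyC n (R := K)) A *m \col_i 'X_i.

Lemma vfhomog0 d : vfhomog d 0.
Proof. by apply/forallP => i; rewrite mxE dhomog0. Qed.

Lemma vfhomogD d u v : vfhomog d u -> vfhomog d v -> vfhomog d (u + v).
Proof.
move=> /forallP hu /forallP hv; apply/forallP => i.
by rewrite mxE; apply: dhomogD; [apply: hu | apply: hv].
Qed.

Lemma vfhomogN d u : vfhomog d u -> vfhomog d (- u).
Proof. by move=> /forallP hu; apply/forallP => i; rewrite mxE dhomogN; apply: hu. Qed.

Lemma vfhomog_linvf A : vfhomog 1 (linvf A).
Proof.
apply/forallP => i; rewrite mxE; apply: rpred_sum => j _.
by rewrite !mxE mul_mpolyC; apply: rpredZ; rewrite dhomogX /= mdeg1.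
Qed.

Lemma dhomog_mderiv (p : {mpoly K[n]}) d (i : 'I_n) :
  p \is d.+1.-homog -> p^`M(i) \is d.-homog.
Proof.
move=> /dhomogP hp; apply/dhomogP => m; rewrite mcoeff_msupp mcoeff_mderiv => h.
have /hp : (m + U_(i))%MM \in msupp p.
  by rewrite mcoeff_msupp; apply: contraNneq h => ->; rewrite mul0rn.
by rewrite /= mdegD mdeg1 addn1 => -[].
Qed.

Lemma mderiv_homog0 (p : {mpoly K[n]}) (i : 'I_n) :
  p \is 0.-homog -> p^`M(i) = 0.
Proof.
move=> /dhomogP hp; apply/mpolyP => m; rewrite mcoeff_mderiv mcoeff0.
suff /memN_msupp_eq0 -> : (m + U_(i))%MM \notin msupp p by rewrite mul0rn.
by apply/negP => /hp; rewrite /= mdegD mdeg1 addn1.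
Qed.

Lemma vfhomog_Dmul d e m u v : vfhomog d u -> vfhomog e v ->
  (d + e = m.+1)%N -> vfhomog m (Dmx v *m u).
Proof.
move=> /forallP hu /forallP hv de; apply/forallP => i.
rewrite mxE; apply: rpred_sum => j _; rewrite mxE.
case: e => [|e] in hv de *; first by rewrite mderiv_homog0 ?mul0r ?dhomog0.
have -> : m = (e + d)%N by move: de; rewrite addnS addnC => -[].
by apply: dhomogM; [apply: dhomog_mderiv | apply: hu].
Qed.

Lemma vfhomog_lie d e m u v : vfhomog d u -> vfhomog e v ->
  (d + e = m.+1)%N -> vfhomog m (lie u v).
Proof.
move=> hu hv de; apply: vfhomogD.
  exact: vfhomog_Dmul hu hv de.
by apply: vfhomogN; apply: vfhomog_Dmul hv hu _; rewrite addnC.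
Qed.

End PolynomialVectorFields.

Arguments lie {K n} u v.
Arguments linvf {K n} A.

Section FormalVectorFields.
Variables (K : fieldType) (n : nat).

Record fvfield := FVField {
  fcomp :> nat -> pvfield K n;
  fcomp_homog : forall k, vfhomog k (fcomp k) }.

Lemma fvfieldP (f g : fvfield) : (forall k, f k = g k) -> f = g.
Proof.
case: f g => [f hf] [g hg] /= /funext fg; subst g.
by rewrite (Prop_irrelevance hf hg).
Qed.

Definition fzero : fvfield := FVField (fun k => vfhomog0 K n k).

Definition flin_comp (A : 'M[K]_n) (k : nat) : pvfield K n :=
  if k == 1%N then linvf A else 0.

Fact flin_homog A k : vfhomog k (flin_comp A k).
Proof.
rewrite /flin_comp; case: eqP => [->|_]; first exact: vfhomog_linvf.
exact: vfhomog0.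
Qed.

Definition flin (A : 'M[K]_n) : fvfield := FVField (flin_homog A).

(* The bracket of fields of degrees j and k has degree j + k - 1, so the degree
   m part collects the pairs with j + k = m + 1. *)
Definition flie_comp (f g : fvfield) (m : nat) : pvfield K n :=
  \sum_(j < m.+2) lie (f j) (g (m.+1 - j)%N).

Fact flie_homog f g m : vfhomog m (flie_comp f g m).
Proof.
rewrite /flie_comp; apply: (big_ind (@vfhomog K n m)) => [||j _].
- exact: vfhomog0.
- by move=> u v; apply: vfhomogD.
- apply: (vfhomog_lie (fcomp_homog f j) (fcomp_homog g _)).
  by rewrite subnKC // -ltnS.
Qed.

Definition flie (f g : fvfield) : fvfield := FVField (flie_homog f g).

End FormalVectorFields.

Arguments flin {K n} A.
Arguments flie {K n} f g.
Arguments fzero {K n}.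

Section JordanChevalley.
Variables (K : fieldType) (n : nat).

(* Subspaces of K^n are row spaces, on which x |-> A x acts as right
   multiplication by A^T. *)
Definition semisimple_mx (A : 'M[K]_n) : Prop :=
  forall U : 'M[K]_n, stablemx U A^T ->
  exists W : 'M[K]_n,
    [/\ stablemx W A^T, (U + W :=: 1%:M)%MS & (U :&: W)%MS = 0].

Definition nilpotent_mx (A : 'M[K]_n) : Prop := exists k : nat, A ^+ k = 0.

Definition jordan_chevalley (A As An : 'M[K]_n) : Prop :=
  [/\ A = As + An, semisimple_mx As, nilpotent_mx An & comm_mx As An].

End JordanChevalley.

(* Main.v *)
(* By induction on the degree r, suppose that ad_As kills g_j for j < r. Applying
   ad_As to the degree r part of [g, f] = 0, the Jacobi identity leaves
   ad_A h = 0 with h = ad_As g_r, i.e. ad_As h = - ad_An h. As ad_An commutes with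
   ad_As and is locally nilpotent, ad_As^(k+1) g_r = 0 for some k. Over an
   algebraically closed field As is diagonalizable, products of linear eigenforms
   and eigenvectors are eigenvectors of ad_As, and these span the polynomial
   fields; hence ad_As^(k+1) and ad_As have the same kernel, so h = 0. *)
Require Import Defs.
From mathcomp Require Import all_boot all_order all_algebra.
From mathcomp Require Import reals mpoly.
From HB Require Import structures.
From mathcomp Require Import separable complex ring.

Set Implicit Arguments.
Unset Strict Implicit.
Unset Printing Implicit Defensive.

Import GRing.Theory.
Local Open Scope ring_scope.

(** * Iterates of commuting additive operators *)

Section CommutingOperators.
Variable V : zmodType.
Implicit Types (S T N D : {additive V -> V}) (v : V).

Lemma iter_additive0 T k : iter k T 0 = 0.
Proof. by elim: k => //= k ->; rewrite raddf0. Qed.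

Lemma iter_additive_eq0 T k m v : (k <= m)%N -> iter k T v = 0 -> iter m T v = 0.
Proof. by move=> /subnK <- h; rewrite iterD h iter_additive0. Qed.

Lemma iter_comm T N k v : (forall w, T (N w) = N (T w)) ->
  T (iter k N v) = iter k N (T v).
Proof. by move=> TN; elim: k => //= k <-. Qed.

Lemma iter_additiveD T k v w : iter k T (v + w) = iter k T v + iter k T w.
Proof. by elim: k => //= k ->; rewrite raddfD. Qed.

Lemma iter_additiveB T k v w : iter k T (v - w) = iter k T v - iter k T w.
Proof. by elim: k => //= k ->; rewrite raddfB. Qed.

(** Induction on [a + b]: as [D] and [N] commute, passing to [D v] lowers [a] and passing to [N v]
    lowers [b]. *)
Lemma iter_nil_sub T D N (v : V) a b :
    (forall w, T w = D w - N w) -> (forall w, D (N w) = N (D w)) ->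
  iter a D v = 0 -> iter b N v = 0 -> iter (a + b) T v = 0.
Proof.
move=> TE DN; move: {2}(a + b)%N (erefl (a + b)%N) => m.
elim: m a b v => [|m IH] [|a] [|b] v // mE.
- by rewrite /= => -> _; exact: (iter_additive0 T b.+1).
- by rewrite addn0 /= => _ ->; exact: (iter_additive0 T a.+1).
move=> Dv Nv; rewrite addSn iterSr TE iter_additiveB; move: mE; rewrite addSn => -[mE].
rewrite (IH a b.+1) //; last 2 first.
- by rewrite -iterSr.
- by rewrite -iter_comm // [iter _ _ _]Nv raddf0.
rewrite -addSnnS in mE *; rewrite (IH a.+1 b) ?subrr //; last by rewrite -iterSr.
by rewrite -iter_comm ?[iter _ _ _]Dv ?raddf0// => w; rewrite DN.
Qed.

(** In effect [T^k v = (-1)^k N^k v]: the relation [T v = - N v] passes from [v] to [N v]. *)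
Lemma iter_opp_nil T N v k : (forall w, T (N w) = N (T w)) ->
  T v + N v = 0 -> iter k N v = 0 -> iter k T v = 0.
Proof.
move=> TN; elim: k v => // k IH v TNv; rewrite !iterSr => Nv.
have -> : T v = - N v by apply/eqP; rewrite -addr_eq0 TNv.
by rewrite -sub0r iter_additiveB iter_additive0 IH ?subr0// TN -raddfD TNv raddf0.
Qed.

End CommutingOperators.

(** * Sums of eigenvectors *)

Section EigenSums.
Variables (F : fieldType) (B : nzRingType) (c : {rmorphism F -> B}).
Variables (V : lmodType B) (T : {additive V -> V}).

(** Eigenvalues lie in [F] and act through [c]: for vector fields [B] is the polynomial ring, over
    which brackets are not linear in general. *)
Inductive eigensum : V -> Prop :=
| eigensum0 : eigensum 0
| eigensum_cons a w v : T w = c a *: w -> eigensum v -> eigensum (w + v).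

Lemma eigensumD v w : eigensum v -> eigensum w -> eigensum (v + w).
Proof.
elim=> [|a u {}v Tu _ IH] hw; rewrite ?add0r// -addrA.
by apply: eigensum_cons Tu _; exact: IH.
Qed.

Lemma eigensum_eigenvector a w : T w = c a *: w -> eigensum w.
Proof. by move=> Tw; rewrite -[w]addr0; apply: eigensum_cons Tw eigensum0. Qed.

Lemma eigensum_sum (I : finType) (w : I -> V) :
  (forall i, eigensum (w i)) -> eigensum (\sum_i w i).
Proof. by move=> h; apply: big_ind => //; [apply: eigensum0 | apply: eigensumD]. Qed.

Hypothesis TZ : forall a v, T (c a *: v) = c a *: T v.

(** The value [p(T) v]. *)
Definition poly_op (p : {poly F}) v := \sum_(i < size p) c p`_i *: iter i T v.

Lemma poly_op_wide m (p : {poly F}) v : (size p <= m)%N ->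
  poly_op p v = \sum_(i < m) c p`_i *: iter i T v.
Proof.
move=> pm; rewrite /poly_op (big_ord_widen _ (fun i => c p`_i *: iter i T v) pm).
rewrite big_mkcond; apply: eq_bigr => i _; case: ltnP => // h.
by rewrite nth_default// rmorph0 scale0r.
Qed.

Lemma poly_opD p v w : poly_op p (v + w) = poly_op p v + poly_op p w.
Proof. by rewrite -big_split; apply: eq_bigr => i _; rewrite iter_additiveD scalerDr. Qed.

Lemma poly_op_eigenvector p a w : T w = c a *: w -> poly_op p w = c p.[a] *: w.
Proof.
move=> Tw; have Tiw i : iter i T w = c (a ^+ i) *: w.
  by elim: i => [|i /= ->]; rewrite ?rmorph1 ?scale1r// TZ Tw scalerA -rmorphM exprSr.
rewrite horner_coef rmorph_sum scaler_suml; apply: eq_bigr => i _.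
by rewrite Tiw scalerA -rmorphM.
Qed.

(** [s] lists the eigenvalues of the summands; [p(T)] multiplies the summand for [a] by [p(a)]. *)
Lemma eigensum_annihilated v : eigensum v ->
  exists s : seq F, forall p, all (root p) s -> poly_op p v = 0.
Proof.
elim=> [|a w {}v Tw _ [s sP]].
  by exists [::] => p _; apply: big1 => i _; rewrite iter_additive0 scaler0.
exists (a :: s) => p /andP[/eqP pa /sP pv].
by rewrite poly_opD pv (poly_op_eigenvector _ Tw) pa rmorph0 scale0r addr0.
Qed.

(* A Bezout relation gives a polynomial [p = X mod X^(k+1)] vanishing on the
   eigenvalues; then [0 = p(T) v = T v]. *)
Lemma eigensum_ker k v : eigensum v -> iter k T v = 0 -> T v = 0.
Proof.
move=> /eigensum_annihilated [s sP] Tkv.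
(* Only nonzero eigenvalues enter, so that [q] is coprime to [X^k]; the eigenvalue 0 is covered by
   the factor [X] below. *)
pose q := \prod_(a <- s | a != 0) ('X - a%:P).
have /Bezout_eq1_coprimepP [[u w] /= uw] : coprimep ('X^k) q.
  apply: coprimep_expl; apply: (big_ind (fun r => coprimep 'X r)) => [||a a0].
  - exact: coprimep1.
  - by move=> x y hx hy; rewrite coprimepMr hx hy.
  - by rewrite coprimep_XsubC rootX.
have pE : 'X * (w * q) = 'X - 'X^(k.+1) * u.
  rewrite -[w * q](addKr (u * 'X^k)) uw mulrDr mulr1 mulrN addrC.
  by rewrite exprS -mulrA [u * _]mulrC.
have /sP : all (root ('X * (w * q))) s.
  apply/allP => a sa; rewrite !rootM rootX; have [//|a0] := eqVneq a 0.
  by rewrite /q -big_filter root_prod_XsubC mem_filter a0 sa !orbT.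
rewrite pE; set p := _ - _.
(* At least two terms are kept so that index 1 exists. *)
rewrite (poly_op_wide _ (leq_maxl (size p) 2)).
rewrite (bigD1 (Ordinal (leq_maxr (size p) 2))) //= big1 ?addr0.
  rewrite coefB coefX coefXnM; case: ltnP => [_|]; last first.
    (* For [k = 0] the coefficient of degree 1 may differ from 1, but then [v = 0]. *)
    by rewrite ltnS leqn0 => /eqP k0; move: Tkv; rewrite k0 /= => ->; rewrite raddf0.
  by rewrite subr0 rmorph1 scale1r.
move=> i i1; rewrite coefB coefX coefXnM.
have -> : (i == 1%N :> nat) = false by apply/negbTE.
case: ltnP => [_|ki]; first by rewrite subrr rmorph0 scale0r.
by rewrite (iter_additive_eq0 (ltnW ki) Tkv) scaler0.
Qed.

End EigenSums.

(* Locked: failed conversion checks between brackets unfold [lie], which does not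
   terminate in practice. *)
HB.lock Definition vlie (K : fieldType) n (u v : pvfield K n) : pvfield K n := lie u v.
Canonical vlie_unlockable := Unlockable vlie.unlock.

(** * Derivations, brackets and the adjoint action of linear fields *)

Section PolynomialFields.
Variables (K : fieldType) (n : nat).
Implicit Types (u v w : pvfield K n) (p q : {mpoly K[n]}) (A B : 'M[K]_n).

(** The Lie derivative of [p] along [u]. *)
Definition vder u p := \sum_j p^`M(j) * u j 0.

Lemma vder_is_additive u : additive (vder u).
Proof. by move=> p q; rewrite -sumrB; apply: eq_bigr => j _; rewrite mderivB mulrBl. Qed.

HB.instance Definition _ u :=
  GRing.isAdditive.Build {mpoly K[n]} {mpoly K[n]} (vder u) (vder_is_additive u).

Lemma vderB u p q : vder u (p - q) = vder u p - vder u q.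
Proof. exact: raddfB. Qed.

Lemma vderM u p q : vder u (p * q) = vder u p * q + p * vder u q.
Proof.
rewrite mulr_suml mulr_sumr -big_split; apply: eq_bigr => j _.
by rewrite mderivM /=; ring.
Qed.

Lemma vderC u a : vder u a%:MP = 0.
Proof. by apply: big1 => j _; rewrite mderivC mul0r. Qed.

Lemma vderX u i : vder u 'X_i = u i 0.
Proof.
rewrite /vder (bigD1 i)//= big1 ?addr0 => [|j ji].
  have -> : 'X_i^`M(i) = 1 :> {mpoly K[n]}; last by rewrite mul1r.
  rewrite mderivX mnm1E eqxx scale1r -mpolyX0; congr mpolyX.
  by apply/mnmP => k; rewrite mnmBE subnn mnmE.
by rewrite mderivX mnm1E eq_sym (negbTE ji) scale0r mul0r.
Qed.

Lemma vlieE u v i : vlie u v i 0 = vder u (v i 0) - vder v (u i 0).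
Proof.
by rewrite unlock /lie !mxE; congr (_ - _); apply: eq_bigr => j _; rewrite mxE.
Qed.

(** The second-order terms cancel by symmetry of the Hessian of [p]. *)
Lemma vder_vlie u v p : vder (vlie u v) p = vder u (vder v p) - vder v (vder u p).
Proof.
have vder2 x y : vder x (vder y p) =
    \sum_j p^`M(j) * vder x (y j 0) + \sum_j \sum_k p^`M(j)^`M(k) * x k 0 * y j 0.
  rewrite raddf_sum -big_split; apply: eq_bigr => j _ /=.
  by rewrite vderM addrC mulr_suml.
rewrite !vder2 [X in _ - (_ + X)]exchange_big /= opprD addrACA.
rewrite [X in _ + X](_ : _ = 0) ?addr0.
  by rewrite -sumrB; apply: eq_bigr => j _; rewrite vlieE mulrBr.
apply/eqP; rewrite subr_eq0; apply/eqP; apply: eq_bigr => j _; apply: eq_bigr => k _.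
by rewrite mderiv_comm mulrAC.
Qed.

Lemma vderBl u v p : vder (u - v) p = vder u p - vder v p.
Proof. by rewrite -sumrB; apply: eq_bigr => j _; rewrite !mxE mulrBr. Qed.

Lemma vfieldP u v : (forall i, u i 0 = v i 0) -> u = v.
Proof. by move=> uv; apply/matrixP => i j; rewrite ord1 uv. Qed.

Lemma vlieN u v : vlie u v = - vlie v u.
Proof. by rewrite unlock /lie opprB. Qed.

Lemma vfieldBE u v i : (u - v) i 0 = u i 0 - v i 0.
Proof. by rewrite !mxE. Qed.

Lemma vlie_is_additive u : additive (vlie u).
Proof.
move=> v w; apply: vfieldP => i.
by rewrite [RHS]vfieldBE !vlieE vderBl vfieldBE raddfB /=; ring.
Qed.

HB.instance Definition _ u :=
  GRing.isAdditive.Build (pvfield K n) (pvfield K n) (vlie u) (vlie_is_additive u).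

Lemma vlieZ u v a : vlie u (a%:MP *: v) = a%:MP *: vlie u v.
Proof.
apply: vfieldP => i; rewrite [RHS]mxE !vlieE [in LHS]mxE vderM vderC mul0r add0r.
rewrite mulrBr; congr (_ - _); rewrite mulr_sumr; apply: eq_bigr => j _.
by rewrite mxE mulrCA.
Qed.

Lemma vlie_jacobi u v w : vlie u (vlie v w) = vlie (vlie u v) w + vlie v (vlie u w).
Proof.
by apply: vfieldP => i; rewrite [RHS]mxE !vlieE !vder_vlie !vderB; ring.
Qed.

Lemma linvfE A i : linvf A i 0 = \sum_j (A i j)%:MP * 'X_j.
Proof. by rewrite mxE; apply: eq_bigr => j _; rewrite !mxE. Qed.

Lemma linvf1 i : linvf (1%:M : 'M[K]_n) i 0 = 'X_i.
Proof. by rewrite /linvf map_mx1 mul1mx mxE. Qed.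

Lemma mulmx_linvf A B : map_mx (mpolyC n (R := K)) A *m linvf B = linvf (A *m B).
Proof. by rewrite /linvf map_mxM mulmxA. Qed.

Lemma vder_linvf u A i : vder u (linvf A i 0) = \sum_j (A i j)%:MP * u j 0.
Proof.
rewrite linvfE raddf_sum; apply: eq_bigr => j _ /=.
by rewrite vderM vderC vderX mul0r add0r.
Qed.

(** Splits [ad_A] into a componentwise derivation and a constant matrix, which can be iterated and
    diagonalized separately. *)
Lemma vlie_linvf A v :
  vlie (linvf A) v = map_mx (vder (linvf A)) v - map_mx (mpolyC n (R := K)) A *m v.
Proof.
apply: vfieldP => i; rewrite [LHS]vlieE [RHS]vfieldBE vder_linvf; congr (_ - _).
  by rewrite mxE.
by rewrite mxE; apply: eq_bigr => j _; rewrite mxE.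
Qed.

Lemma map_vder_linvf A B :
  map_mx (vder (linvf A)) (linvf B) = linvf (B *m A).
Proof.
apply: vfieldP => i; rewrite mxE vder_linvf -mulmx_linvf [RHS]mxE.
by apply: eq_bigr => j _; rewrite [in RHS]mxE.
Qed.

Lemma vder_linvf_linvf A B i : vder (linvf A) (linvf B i 0) = linvf (B *m A) i 0.
Proof. by rewrite -map_vder_linvf [RHS]mxE. Qed.

Lemma linvfM A B i : linvf (A *m B) i 0 = \sum_j (A i j)%:MP * linvf B j 0.
Proof. by rewrite -map_vder_linvf mxE vder_linvf. Qed.

Lemma vlie_linvf_linvf A B : vlie (linvf A) (linvf B) = linvf (B *m A) - linvf (A *m B).
Proof. by rewrite vlie_linvf map_vder_linvf mulmx_linvf. Qed.

Lemma vlie_linvfD A B v : vlie (linvf (A + B)) v = vlie (linvf A) v + vlie (linvf B) v.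
Proof. by rewrite {1}/linvf map_mxD mulmxDl vlieN raddfD opprD /= -!vlieN. Qed.

(** Jacobi identity, the bracket of the two linear fields being zero. *)
Lemma vlie_linvf_comm A B v : comm_mx A B ->
  vlie (linvf A) (vlie (linvf B) v) = vlie (linvf B) (vlie (linvf A) v).
Proof.
move=> AB; rewrite vlie_jacobi vlie_linvf_linvf -AB subrr.
by rewrite vlieN raddf0 oppr0 add0r.
Qed.

(** Suited to properties of derivations, which the Leibniz rule carries from factors to products. *)
Lemma mpoly_alg_ind (P : {mpoly K[n]} -> Prop) :
    (forall a, P a%:MP) -> (forall i, P 'X_i) ->
    (forall p q, P p -> P q -> P (p + q)) -> (forall p q, P p -> P q -> P (p * q)) ->
  forall p, P p.
Proof.
move=> PC PX PD PM; elim/mpolyind => [|a m p _ _ Pp]; first by rewrite -[0]mpolyC0.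
apply: (PD) => //; rewrite -mul_mpolyC; apply: (PM) => //.
rewrite mpolyXE_id; apply: (big_ind P) => [||i _]; [exact: (PC 1) | exact: PM |].
by elim: (m i) => [|k IH]; [exact: (PC 1) | rewrite exprS; apply: PM].
Qed.

Section Nilpotent.
Variable A : 'M[K]_n.
Hypothesis A_nil : nilpotent_mx A.
Let D : {additive {mpoly K[n]} -> {mpoly K[n]}} := vder (linvf A).

Lemma iter_vder_nil p : exists k, iter k D p = 0.
Proof.
elim/mpoly_alg_ind: p => [a|i|p q [a ap] [b bq]|p q [a ap] [b bq]].
- by exists 1%N; apply: vderC.
- have [k Ak] := A_nil; exists k.
  suff -> : iter k D 'X_i = linvf (A ^+ k) i 0 by rewrite Ak /linvf map_mx0 mul0mx mxE.
  elim: k {Ak} => [|m IH]; first by rewrite expr0 linvf1.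
  by rewrite iterS IH exprSr -vder_linvf_linvf.
- exists (maxn a b); rewrite iter_additiveD.
  rewrite (iter_additive_eq0 (leq_maxl _ _) ap).
  by rewrite (iter_additive_eq0 (leq_maxr _ _) bq) addr0.
(* By the Leibniz rule, each [D] applied to [p * q] lowers the exponent needed for one factor. *)
- exists (a + b)%N; move: {2}(a + b)%N (erefl (a + b)%N) => m.
  elim: m a b p q ap bq => [|m IH] [|a] [|b] p q // ap bq mE.
  + by move: ap => /= ->; rewrite mul0r.
  + by move: ap => /= ->; rewrite mul0r; exact: (iter_additive0 D b.+1).
  + by move: bq => /= ->; rewrite mulr0 addn0; exact: (iter_additive0 D a.+1).
  rewrite addSn iterSr [D _]vderM iter_additiveD; move: mE; rewrite addSn => -[mE].
  by rewrite IH ?add0r // -?iterSr// -addSnnS IH -?iterSr// addSnnS.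
Qed.

(** The derivation part of [ad_A] is locally nilpotent, the matrix part is nilpotent, and the two
    commute. *)
Lemma iter_vlie_linvf_nil v : exists k, iter k (vlie (linvf A)) v = 0.
Proof.
pose Dv : {additive pvfield K n -> pvfield K n} := map_mx D.
pose N : {additive pvfield K n -> pvfield K n} := mulmx (map_mx (mpolyC n (R := K)) A).
have [a va] : exists a, iter a Dv v = 0.
  have /fin_all_exists [k vk] : forall i, exists k, iter k D (v i 0) = 0.
    by move=> i; apply: iter_vder_nil.
  exists (\max_i k i); apply: vfieldP => i; rewrite mxE.
  have -> m : iter m Dv v i 0 = iter m D (v i 0).
    by elim: m => //= m <-; rewrite mxE.
  exact: iter_additive_eq0 (leq_bigmax i) (vk i).
have [b Ab] := A_nil; exists (a + b)%N.
apply: (@iter_nil_sub _ _ Dv N) => // [w|w|].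
- exact: vlie_linvf.
- apply: vfieldP => i; rewrite !mxE raddf_sum; apply: eq_bigr => j _ /=.
  by rewrite !mxE vderM vderC mul0r add0r.
have -> : iter b N v = map_mx (mpolyC n (R := K)) (A ^+ b) *m v.
  elim: (b) => [|m /= ->]; first by rewrite expr0 map_mx1 mul1mx.
  by rewrite /N mulmxA -map_mxM exprS.
by rewrite Ab map_mx0 mul0mx.
Qed.

End Nilpotent.

Section Diagonalizable.
Variables (A P : 'M[K]_n) (d : 'rV[K]_n).
Hypotheses (P_unit : P \in unitmx) (PA : P *m A = diag_mx d *m P).
Let D : {additive {mpoly K[n]} -> {mpoly K[n]}} := vder (linvf A).

(** Rows of [P] are left eigenvectors of [A], so the forms [linvf P j] are eigenvectors of [D]
    spanning the linear forms; in products, eigenvalues add. *)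
Lemma eigensum_vder p : eigensum (idfun : {rmorphism K -> K}) D p.
Proof.
elim/mpoly_alg_ind: p => [a|i|p q|p q hp hq].
- by apply: (@eigensum_eigenvector _ _ _ _ _ 0); rewrite /= [D _]vderC scale0r.
- have -> : 'X_i = \sum_j invmx P i j *: linvf P j 0.
    rewrite -linvf1 -(mulVmx P_unit) linvfM.
    by apply: eq_bigr => j _; rewrite mul_mpolyC.
  apply: eigensum_sum => j; apply: (@eigensum_eigenvector _ _ _ _ _ (d 0 j)) => /=.
  have -> : D (invmx P i j *: linvf P j 0) = invmx P i j *: D (linvf P j 0).
    by rewrite -!mul_mpolyC [LHS]vderM vderC mul0r add0r.
  rewrite scalerA mulrC -scalerA; congr (_ *: _).
  rewrite [LHS]vder_linvf_linvf PA linvfM (bigD1 j)//= big1 ?addr0.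
    by rewrite mxE eqxx mulr1n mul_mpolyC.
  by move=> k kj; rewrite mxE eq_sym (negbTE kj) mpolyC0 mul0r.
- exact: eigensumD.
elim: hp => [|a u {}p Du _ IH]; first by rewrite mul0r; apply: eigensum0.
rewrite mulrDl; apply: (eigensumD _ IH).
elim: hq {IH} => [|b v {}q Dv _ IH]; first by rewrite mulr0; apply: eigensum0.
rewrite mulrDr; apply: (eigensumD _ IH).
apply: (@eigensum_eigenvector _ _ _ _ _ (a + b)) => /=.
by rewrite [D _]vderM [vder _ u]Du [vder _ v]Dv /= -scalerAl -scalerAr scalerDl.
Qed.

Lemma eigensum_vlie_linvf v : eigensum (mpolyC n (R := K)) (vlie (linvf A)) v.
Proof.
pose c : {rmorphism K -> {mpoly K[n]}} := mpolyC n (R := K).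
(* Expansion along the columns of [P^-1], constant fields that are eigenvectors of [A]. *)
have -> : v = \sum_i (map_mx c P *m v) i 0 *: col i (map_mx c (invmx P)).
  rewrite -[LHS]mul1mx -(map_mx1 c) -(mulVmx P_unit) map_mxM -mulmxA.
  by apply: vfieldP => i; rewrite mxE summxE; apply: eq_bigr => j _; rewrite !mxE mulrC.
apply: eigensum_sum => i.
elim: (eigensum_vder ((map_mx c P *m v) i 0)) => [|a u p Du _ IH].
  by rewrite scale0r; apply: eigensum0.
rewrite scalerDl; apply: (eigensumD _ IH).
(* The coefficient [u] contributes [a] through the derivation, the column [- d 0 i] through the
   matrix. *)
apply: (@eigensum_eigenvector _ _ _ _ _ (a - d 0 i)).
have AP : A *m col i (invmx P) = d 0 i *: col i (invmx P).
  have AP : A *m invmx P = invmx P *m diag_mx d.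
    by apply: (canLR (mulmxK P_unit)); rewrite -mulmxA -PA mulKmx.
  rewrite [in LHS]colE mulmxA AP -colE mul_mx_diag.
  by apply/matrixP => j k; rewrite !mxE mulrC.
rewrite [LHS]vlie_linvf -scalemxAr -map_col -map_mxM AP.
apply: vfieldP => j; rewrite !mxE vderM vderC mulr0 addr0 [vder _ u]Du /=.
by rewrite -mul_mpolyC mpolyCM mpolyCB; ring.
Qed.

End Diagonalizable.
End PolynomialFields.

(** * Diagonalization of semisimple matrices over a closed field *)

(* An invariant complement W of ker N satisfies W N <= W and (W N) N = 0, so
   W N = 0 and W = 0. *)
Lemma semisimple_sqr_eq0 (K : fieldType) (n : nat) (A N : 'M[K]_n) :
    semisimple_mx A -> (forall W : 'M_n, stablemx W A^T -> stablemx W N) ->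
  comm_mx N A^T -> N *m N = 0 -> N = 0.
Proof.
move=> ssA stabN comN N2.
have [W [WA UW capUW]] := ssA (kermx N) (comm_mx_stable_ker comN).
have WU : (W <= kermx N)%MS.
  apply/sub_kermxP/eqP; rewrite -submx0 -capUW sub_capmx stabN //.
  by rewrite andbT; apply/sub_kermxP; rewrite -mulmxA N2 mulmx0.
have : (1%:M <= kermx N)%MS by rewrite -UW addsmx_sub submx_refl.
by move=> /sub_kermxP; rewrite mul1mx.
Qed.

Lemma semisimple_mxminpoly_separable (K : fieldType) (n : nat) (A : 'M[K]_n.+1) :
  [pchar K] =i pred0 -> semisimple_mx A -> separable_poly (mxminpoly A^T).
Proof.
move=> charK ssA; apply/separable_polyP; split; last first.
  (* In characteristic 0 a nonconstant polynomial has nonzero derivative, so square-freeness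
     remains. *)
  move=> u _; case su: (size u) => [|[|m]] // _.
  apply/eqP => /(congr1 (fun q : {poly K} => q`_m)); rewrite coef_deriv coef0 => /eqP.
  rewrite -mulr_natr mulf_eq0; have /pcharf0P -> := charK; rewrite orbF.
  have -> : u`_m.+1 = lead_coef u by rewrite lead_coefE su.
  by rewrite lead_coef_eq0 -size_poly_eq0 su.
apply/poly_square_freeP => d; apply: contra => /dvdpP [r qE].
(* The minimal polynomial is [r * d^2], so [N] squares to 0 and hence vanishes; minimality then
   makes [d] constant. *)
pose N := horner_mx A^T (r * d).
have N0 : N = 0.
  apply: (semisimple_sqr_eq0 ssA) => [W||].
  - exact: horner_mx_stable.
  - exact/comm_mx_sym/comm_mx_horner.
  rewrite -[N *m N]/(N * N) -rmorphM mulrACA -mulrA -[d * d]expr2 -qE.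
  by rewrite rmorphM /= mx_root_minpoly mulr0.
have := mxminpoly_min N0; have := monic_neq0 (mxminpoly_monic A^T).
rewrite qE expr2 mulrA mulf_eq0 => /norP [rd0 d0].
by rewrite -[X in _ %| X]mulr1 dvdp_mul2l // dvdp1.
Qed.

(** The separable minimal polynomial splits over [L] with distinct roots. *)
Lemma semisimple_diagonalizable (K : fieldType) (L : closedFieldType)
    (f : {rmorphism K -> L}) (n : nat) (A : 'M[K]_n) :
    [pchar K] =i pred0 -> semisimple_mx A ->
  exists P d, P \in unitmx /\ P *m map_mx f A = diag_mx d *m P.
Proof.
case: n A => [|n] A charK ssA.
  by exists 1%:M, 0; rewrite unitmx1; split; last rewrite [LHS]flatmx0 [RHS]flatmx0.
have [Q Q_unit] : diagonalizable (map_mx f A^T).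
  apply/diagonalizableP; rewrite mxminpoly_map.
  have := semisimple_mxminpoly_separable charK ssA.
  rewrite -(separable_map f).
  have [rs ->] := closed_field_poly_normal (map_poly f (mxminpoly A^T)).
  rewrite lead_coef_map (monicP (mxminpoly_monic _)) rmorph1 scale1r => sep.
  by exists rs; rewrite // -separable_prod_XsubC.
move=> /diagonalizable_forPex [d /(simmxP Q_unit) QA].
(* [Q] diagonalizes the transpose of [A]; transposing back turns it into its inverse transpose. *)
exists (invmx Q)^T, d; split; first by rewrite unitmx_tr unitmx_inv.
apply: trmx_inj; rewrite !trmx_mul !trmxK tr_diag_mx map_trmx.
by apply: (canRL (mulKmx Q_unit)); rewrite mulmxA QA mulmxK.
Qed.

(** * Extension of scalars *)

Section BaseChange.
Variables (K L : fieldType) (iota : {rmorphism K -> L}) (n : nat).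
Implicit Types (u v : pvfield K n).

Definition map_vfield u : pvfield L n := map_mx (map_mpoly iota) u.

Lemma map_mpoly_mderiv (p : {mpoly K[n]}) i :
  map_mpoly iota p^`M(i) = (map_mpoly iota p)^`M(i).
Proof.
by apply/mpolyP => m; rewrite mcoeff_map_mpoly !mcoeff_mderiv mcoeff_map_mpoly raddfMn.
Qed.

Lemma map_vfield_vlie u v : map_vfield (vlie u v) = vlie (map_vfield u) (map_vfield v).
Proof.
have map_vder x p : map_mpoly iota (vder x p) = vder (map_vfield x) (map_mpoly iota p).
  by rewrite rmorph_sum; apply: eq_bigr => j _; rewrite rmorphM /= map_mpoly_mderiv mxE.
by apply: vfieldP => i; rewrite mxE !vlieE rmorphB /= !map_vder [in RHS]mxE [in RHS]mxE.
Qed.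

Lemma map_vfield_linvf (A : 'M[K]_n) : map_vfield (linvf A) = linvf (map_mx iota A).
Proof.
apply: vfieldP => i; rewrite mxE !linvfE rmorph_sum; apply: eq_bigr => j _.
by rewrite rmorphM /= map_mpolyC map_mpolyX mxE.
Qed.

Lemma map_vfield_eq0 u : map_vfield u = 0 -> u = 0.
Proof.
move=> u0; apply: vfieldP => i; apply/mpolyP => m; apply: (fmorph_inj iota).
rewrite -mcoeff_map_mpoly.
have := congr1 (fun w : pvfield L n => w i 0) u0.
by rewrite !mxE => ->; rewrite !mcoeff0 rmorph0.
Qed.

End BaseChange.

(** * Kernels of adjoint actions and the centralizer of a normal form *)

Lemma semisimple_ad_ker (K : fieldType) (L : closedFieldType)
    (iota : {rmorphism K -> L}) (n k : nat) (A : 'M[K]_n) (v : pvfield K n) :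
    [pchar K] =i pred0 -> semisimple_mx A ->
  iter k (vlie (linvf A)) v = 0 -> vlie (linvf A) v = 0.
Proof.
move=> charK ssA Tkv;
have [P [d [P_unit PA]]] := semisimple_diagonalizable iota charK ssA.
(* Vanishing is tested over [L], where [A] is diagonalizable. *)
apply: (@map_vfield_eq0 _ _ iota); rewrite map_vfield_vlie map_vfield_linvf.
have Tkw : iter k (vlie (linvf (map_mx iota A))) (map_vfield iota v) = 0.
  suff -> : iter k (vlie (linvf (map_mx iota A))) (map_vfield iota v) =
            map_vfield iota (iter k (vlie (linvf A)) v).
    by rewrite Tkv; apply: vfieldP => i; rewrite !mxE rmorph0.
  by elim: k {Tkv} => // k IH; rewrite !iterS IH map_vfield_vlie map_vfield_linvf.
apply: eigensum_ker (eigensum_vlie_linvf P_unit PA _) Tkw => a w.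
exact: vlieZ.
Qed.

Lemma vlie_semisimple_part (K : fieldType) (L : closedFieldType)
    (iota : {rmorphism K -> L}) (n : nat) (A As An : 'M[K]_n) (v : pvfield K n) :
    [pchar K] =i pred0 -> jordan_chevalley A As An ->
  vlie (linvf A) (vlie (linvf As) v) = 0 -> vlie (linvf As) v = 0.
Proof.
move=> charK [-> ssAs nilAn AsAn] Av.
have [k Nk] := iter_vlie_linvf_nil nilAn (vlie (linvf As) v).
(* One more iterate, since [k] belongs to [[As, v]] rather than [v]. *)
apply: (semisimple_ad_ker iota (k := k.+1) charK ssAs); rewrite iterSr.
apply: (@iter_opp_nil _ (vlie (linvf As)) (vlie (linvf An))) => //.
  by move=> w; apply: vlie_linvf_comm.
by rewrite -vlie_linvfD.
Qed.

Lemma normal_form_centralizer (K : fieldType) (L : closedFieldType)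
    (iota : {rmorphism K -> L}) (n : nat) (A As An : 'M[K]_n) (f g : fvfield K n) :
    [pchar K] =i pred0 -> jordan_chevalley A As An ->
    f 0%N = 0 -> f 1%N = linvf A ->
    flie (flin As) f = fzero -> flie g f = fzero ->
  flie g (flin As) = fzero.
Proof.
move=> charK JC f0 f1 Asf gf.
have lieV u v : @lie K n u v = vlie u v by rewrite [vlie]unlock.
have {Asf} Asf k : vlie (linvf As) (f k) = 0.
  have := congr1 (fun h : fvfield K n => h k) Asf.
  (* Only [j = 1] survives: [flin As] lives in degree 1. *)
  rewrite /= /flie_comp big_ord_recl big_ord_recl big1 => [|j _].
    rewrite /= /flin_comp /= !lieV subSS subn0 addr0.
    by rewrite vlieN raddf0 oppr0 add0r subn0.
  by rewrite lieV /= /flin_comp /= vlieN raddf0 oppr0.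
suff Asg k : vlie (linvf As) (g k) = 0.
  apply: fvfieldP => m; apply: big1 => j _; rewrite lieV /= /flin_comp.
  by case: eqP => _; rewrite ?raddf0 // vlieN Asg oppr0.
elim/ltn_ind: k => r IH; apply: (vlie_semisimple_part iota charK JC).
have := congr1 (fun h : fvfield K n => vlie (linvf As) (h r)) gf.
(* Isolates [[g r, f 1]] and [[g r.+1, f 0]]; the latter vanishes because [f 0 = 0]. *)
rewrite /= /flie_comp !big_ord_recr /= subnn subSnn f0 f1 lieV [lie _ 0]lieV.
rewrite [vlie (g r.+1) 0]raddf0 addr0 [LHS]raddfD raddf_sum big1 ?add0r => [|j _].
  rewrite raddf0 /= (vlie_jacobi (linvf As) (g r)) -f1 Asf raddf0 addr0 f1 => h.
  by rewrite vlieN h oppr0.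
(* For [j < r], [ad_As] kills both entries of the bracket. *)
by rewrite /= lieV vlie_jacobi Asf raddf0 addr0 IH // vlieN raddf0 oppr0.
Qed.

Theorem theorem4p3p5 (R : realType) (s : scalars) (n : nat)
    (A As An : 'M[scalar_field R s]_n) (f g : fvfield (scalar_field R s) n)
    (hA : jordan_chevalley A As An)
    (hf0 : f 0%N = 0%R)
    (hf1 : f 1%N = linvf A)
    (hPD : flie (flin As) f = fzero)
    (hgf : flie g f = fzero) :
  flie g (flin As) = fzero.
Proof.
case: s A As An f g hA hf0 hf1 hPD hgf => A As An f g hA hf0 hf1 hPD hgf.
  have charR := @Num.Theory.pchar_num R.
  exact: (normal_form_centralizer (real_complex R) charR hA hf0 hf1 hPD hgf).
(* Complex scalars are already algebraically closed. *)
pose idC : {rmorphism R[i] -> R[i]} := idfun.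
have charC := @Num.Theory.pchar_num R[i].
exact: (normal_form_centralizer idC charC hA hf0 hf1 hPD hgf).
Qed.
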